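(* Let $\mathcal{A}$ be an abelian category with enough injectives (for example, the category of left modules over a ring) and let $F:\mathcal{A}\to\mathbf{Ab}$ be an additive covariant functor. Consider the right fundamental sequence of $F$, i.e. the sequence of functors and natural transformations $$0\to\overline{F}\to F\xrightarrow{\rho_F}R^0F\xrightarrow{\beta_F}\overline{F}\circ\Sigma\to S^1F\to R^1F\to\overline{F}\circ\Sigma^2\to S^2F\to R^2F\to\overline{F}\circ\Sigma^3\to S^3F\to\cdots .$$ Then: (1) The right fundamental sequence is a complex of functors whose homology is zero except, possibly, at the terms $R^iF$. (2) If $F$ is half-exact, then the sequence is exact. (3) If $F$ is epi-preserving, then $\beta_F$ is epic. (4) If $F$ is mono-preserving, then $\overline{F}=0$ and $\rho_F$ is monic. (5) $\rho_F$ is an isomorphism if and only if $F$ is left-exact.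
   Context: $\mathbf{Ab}$ is the category of abelian groups. A covariant additive functor $F$ is half-exact if for each short exact sequence $0\to A\to B\to C\to0$ the sequence $F(A)\to F(B)\to F(C)$ is exact at $F(B)$. Construction of the right fundamental sequence. For an object $B$ choose an injective resolution $0\to B\to I^0\xrightarrow{d_0}I^1\xrightarrow{d_1}\cdots$. Put $\Sigma^0B=B$, let $m_0:B\to I^0$ be the given embedding, and for $i\ge0$ let $e_i:I^i\to\Sigma^{i+1}B$ be the cokernel of $m_i:\Sigma^iB\to I^i$ and $m_{i+1}:\Sigma^{i+1}B\to I^{i+1}$ the monomorphism with $d_i=m_{i+1}e_i$. Define: - $R^iF(B)=\mathrm{Ker}\,F(d_i)/\mathrm{Im}\,F(d_{i-1})$ (with $\mathrm{Im}\,F(d_{-1}):=0$), the right-derived functors ($R^0F$ need not equal $F$); - the sub-stabilization $\overline{F}(B)=\mathrm{Ker}(F(m_0):F(B)\to F(I^0))$, which equals the kernel of the canonical map $\rho_F:F\to R^0F$ induced by $F(m_0)$; since $\overline{F}$ vanishes on injectives, $\overline{F}\circ\Sigma^i$ is a well-defined functor, with $(\overline{F}\circ\Sigma^i)(B)=\overline{F}(\Sigma^iB)=\mathrm{Ker}\,F(m_i)$; - the right satellites $S^0F=F$ and, for $i\ge1$, $S^iF(B)=\mathrm{Coker}(F(e_{i-1}):F(I^{i-1})\to F(\Sigma^iB))$. These are independent of the choice of resolution and functorial in $B$. The maps of the sequence, for $i\ge0$, are: $\overline{F}(\Sigma^iB)\to S^iF(B)$ is the inclusion $\mathrm{Ker}\,F(m_i)\subseteq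 F(\Sigma^iB)$ followed by the projection onto $S^iF(B)$; $S^iF(B)\to R^iF(B)$ is induced by $F(m_i):F(\Sigma^iB)\to\mathrm{Ker}\,F(d_i)$ (for $i=0$ this is $\rho_F$); $R^iF(B)\to\overline{F}(\Sigma^{i+1}B)$ is induced by $F(e_i):\mathrm{Ker}\,F(d_i)\to\mathrm{Ker}\,F(m_{i+1})$ (for $i=0$ this is $\beta_F$). *)

(* Defs.v *)
From HB Require Import structures.
From mathcomp Require Import all_boot all_algebra.
From mathcomp Require Import boolp.

Set Implicit Arguments.
Unset Strict Implicit.
Unset Printing Implicit Defensive.

Import GRing.Theory.
Local Open Scope ring_scope.

Reserved Notation "g \oc f" (at level 40, left associativity).

Record preadditive_category := PreadditiveCategory {
  object :> Type;
  hom : object -> object -> zmodType;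
  idm : forall X, hom X X;
  comp : forall X Y Z, hom Y Z -> hom X Y -> hom X Z;
  compA : forall X Y Z T (h : hom Z T) (g : hom Y Z) (f : hom X Y),
    comp h (comp g f) = comp (comp h g) f;
  comp1m : forall X Y (f : hom X Y), comp (idm Y) f = f;
  compm1 : forall X Y (f : hom X Y), comp f (idm X) = f;
  compDl : forall X Y Z (g h : hom Y Z) (f : hom X Y),
    comp (g + h) f = comp g f + comp h f;
  compDr : forall X Y Z (g : hom Y Z) (f h : hom X Y),
    comp g (f + h) = comp g f + comp g h
}.

Arguments hom {p}.
Arguments idm {p}.
Arguments comp {p X Y Z}.
Arguments compA {p X Y Z T}.
Arguments comp1m {p X Y}.
Arguments compm1 {p X Y}.
Arguments compDl {p X Y Z}.
Arguments compDr {p X Y Z}.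
Notation "g \oc f" := (comp g f) : ring_scope.

Section Notions.
Variable C : preadditive_category.
Implicit Types X Y Z W : C.

Definition mono X Y (m : hom X Y) : Prop :=
  forall W (g h : hom W X), m \oc g = m \oc h -> g = h.

Definition epi X Y (e : hom X Y) : Prop :=
  forall W (g h : hom Y W), g \oc e = h \oc e -> g = h.

Definition is_kernel K X Y (k : hom K X) (f : hom X Y) : Prop :=
  f \oc k = 0 /\
  forall W (g : hom W X), f \oc g = 0 -> exists! h : hom W K, k \oc h = g.

Definition is_cokernel X Y Q (q : hom Y Q) (f : hom X Y) : Prop :=
  q \oc f = 0 /\
  forall W (g : hom Y W), g \oc f = 0 -> exists! h : hom Q W, h \oc q = g.

Definition short_exact X Y Z (f : hom X Y) (g : hom Y Z) : Prop :=
  is_kernel f g /\ is_cokernel g f.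

Definition is_zero_object Z : Prop :=
  (forall X (f : hom X Z), f = 0) /\ (forall X (f : hom Z X), f = 0).

Definition is_biproduct X Y P (i1 : hom X P) (i2 : hom Y P)
    (p1 : hom P X) (p2 : hom P Y) : Prop :=
  [/\ p1 \oc i1 = idm X, p2 \oc i2 = idm Y, p1 \oc i2 = 0, p2 \oc i1 = 0
    & i1 \oc p1 + i2 \oc p2 = idm P].

Definition injective_object (I : C) : Prop :=
  forall X Y (m : hom X Y), mono m ->
  forall f : hom X I, exists g : hom Y I, g \oc m = f.

Definition enough_injectives : Prop :=
  forall X, exists (I : C) (m : hom X I), injective_object I /\ mono m.

End Notions.

Record abelian_category := AbelianCategory {
  abelian_preadditive :> preadditive_category;
  has_zero : exists Z : abelian_preadditive, is_zero_object Z;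
  has_biproducts : forall X Y : abelian_preadditive,
    exists (P : abelian_preadditive) (i1 : hom X P) (i2 : hom Y P)
           (p1 : hom P X) (p2 : hom P Y), is_biproduct i1 i2 p1 p2;
  has_kernels : forall (X Y : abelian_preadditive) (f : hom X Y),
    exists (K : abelian_preadditive) (k : hom K X), is_kernel k f;
  has_cokernels : forall (X Y : abelian_preadditive) (f : hom X Y),
    exists (Q : abelian_preadditive) (q : hom Y Q), is_cokernel q f;
  mono_is_kernel : forall (X Y : abelian_preadditive) (m : hom X Y),
    mono m -> exists (Z : abelian_preadditive) (g : hom Y Z), is_kernel m g;
  epi_is_cokernel : forall (X Y : abelian_preadditive) (e : hom X Y),
    epi e -> exists (Z : abelian_preadditive) (g : hom Z X), is_cokernel e g
}.

Section PreadditiveTheory.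
Variable C : preadditive_category.
Implicit Types X Y Z W : C.

Lemma compBl X Y Z (g h : hom Y Z) (f : hom X Y) :
  (g - h) \oc f = g \oc f - h \oc f.
Proof. by apply/eqP; rewrite eq_sym subr_eq -compDl subrK. Qed.

Lemma compBr X Y Z (g : hom Y Z) (f h : hom X Y) :
  g \oc (f - h) = g \oc f - g \oc h.
Proof. by apply/eqP; rewrite eq_sym subr_eq -compDr subrK. Qed.

Lemma comp0m X Y Z (f : hom X Y) : (0 : hom Y Z) \oc f = 0.
Proof. by rewrite -(subrr (0 : hom Y Z)) compBl subrr. Qed.

Lemma compm0 X Y Z (f : hom Y Z) : f \oc (0 : hom X Y) = 0.
Proof. by rewrite -(subrr (0 : hom X Y)) compBr subrr. Qed.

Lemma cokernel_epi X Y Q (q : hom Y Q) (f : hom X Y) :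
  is_cokernel q f -> epi q.
Proof.
move=> [qf0 U] W g h E.
have [k [_ uk]] := U W (g \oc q) (etrans (esym (compA g q f))
  (etrans (congr1 (comp g) qf0) (compm0 _ _))).
by rewrite -(uk g erefl) -(uk h (esym E)).
Qed.

End PreadditiveTheory.

(* [zmodType] plays the role of Ab: classically every abelian group carries
   the decidable equality and choice operator that [zmodType] includes. *)

Definition ab_epi (U V : zmodType) (f : {additive U -> V}) : Prop :=
  forall (W : zmodType) (g h : {additive V -> W}),
    (forall x, g (f x) = h (f x)) -> forall y, g y = h y.

Definition ab_mono (U V : zmodType) (f : {additive U -> V}) : Prop :=
  forall (W : zmodType) (g h : {additive W -> U}),
    (forall x, f (g x) = f (h x)) -> forall x, g x = h x.

Definition ab_exact (U V W : zmodType) (f : U -> V) (g : V -> W) : Prop :=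
  forall y, g y = 0 <-> exists x, f x = y.

Definition mk_additive (U V : zmodType) (f : U -> V) (fB : zmod_morphism f) :
  {additive U -> V} := HB.pack f (GRing.isZmodMorphism.Build U V f fB).

Section Kernel.
Variables (U V : zmodType) (f : {additive U -> V}).

Definition ker_pred : {pred U} := [pred x | f x == 0].

Lemma ker_zmod_closed : zmod_closed ker_pred.
Proof.
split=> [|x y]; rewrite !inE ?raddf0 // => /eqP fx /eqP fy.
by rewrite raddfB fx fy subrr.
Qed.

HB.instance Definition _ := GRing.isZmodClosed.Build U ker_pred ker_zmod_closed.

Definition ker := {x : U | x \in ker_pred}.
HB.instance Definition _ := SubChoice.on ker.
HB.instance Definition _ := [SubChoice_isSubZmodule of ker by <:].

Lemma kerP (x : ker) : f (val x) = 0.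
Proof. by apply/eqP; have := valP x; rewrite inE. Qed.

Lemma mem_ker x : f x = 0 -> x \in ker_pred.
Proof. by move=> fx; rewrite inE fx. Qed.

Definition to_ker_fun (W : zmodType) (g : {additive W -> U})
  (fg0 : forall x, f (g x) = 0) (x : W) : ker := Sub (g x) (mem_ker (fg0 x)).

Lemma to_ker_is_zmod_morphism W g fg0 : zmod_morphism (@to_ker_fun W g fg0).
Proof. by move=> x y; apply: val_inj; rewrite /= raddfB. Qed.

Definition to_ker (W : zmodType) (g : {additive W -> U})
  (fg0 : forall x, f (g x) = 0) : {additive W -> ker} :=
  mk_additive (to_ker_is_zmod_morphism fg0).

End Kernel.

Section QuotientGroup.
Variables (U : zmodType) (I : zmodClosed U).

Definition quot : zmodType := Quotient.quot I.

Local Open Scope quotient_scope.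

Definition quot_proj_fun (x : U) : quot := \pi_(Quotient.quot I) x.

Lemma quot_proj_is_zmod_morphism : zmod_morphism quot_proj_fun.
Proof. exact: (raddfB (\pi_(Quotient.quot I))). Qed.

Definition quot_proj : {additive U -> quot} :=
  mk_additive quot_proj_is_zmod_morphism.

Lemma quot_proj_surj (x : quot) : exists y, quot_proj y = x.
Proof. by exists (repr x); rewrite /= /quot_proj_fun reprK. Qed.

Lemma quot_proj_eq0 x : (quot_proj x = 0) <-> x \in I.
Proof.
have -> : (quot_proj x = 0) <-> (quot_proj x = quot_proj 0) by rewrite raddf0.
rewrite -[in x \in I](subr0 x) Quotient.idealrBE.
by split=> [/eqP|/eqP].
Qed.

Variables (V : zmodType) (g : {additive U -> V}).
Hypothesis gI : forall x, x \in I -> g x = 0.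

Lemma quot_lift_subproof x y : quot_proj x = quot_proj y -> g x = g y.
Proof.
move=> E; apply/eqP; rewrite -subr_eq0 -raddfB; apply/eqP/gI/quot_proj_eq0.
by rewrite raddfB E subrr.
Qed.

Definition quot_lift_fun (x : quot) : V := g (repr x).

Lemma quot_lift_funE x : quot_lift_fun (quot_proj x) = g x.
Proof. by apply: quot_lift_subproof; rewrite /= /quot_proj_fun reprK. Qed.

Lemma quot_lift_is_zmod_morphism : zmod_morphism quot_lift_fun.
Proof.
move=> x y; have [a <-] := quot_proj_surj x; have [b <-] := quot_proj_surj y.
by rewrite -raddfB !quot_lift_funE raddfB.
Qed.

Definition quot_lift : {additive quot -> V} :=
  mk_additive quot_lift_is_zmod_morphism.

Lemma quot_liftE x : quot_lift (quot_proj x) = g x.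
Proof. exact: quot_lift_funE. Qed.

End QuotientGroup.

Section Image.
Variables (U V : zmodType) (f : {additive U -> V}).

Definition im_pred : {pred V} := [pred y | `[< exists x, f x = y >]].

Lemma im_zmod_closed : zmod_closed im_pred.
Proof.
split=> [|x y]; rewrite !inE; first by apply/asboolP; exists 0; rewrite raddf0.
move=> /asboolP[a <-] /asboolP[b <-]; apply/asboolP.
by exists (a - b); rewrite raddfB.
Qed.

HB.instance Definition _ := GRing.isZmodClosed.Build V im_pred im_zmod_closed.

Lemma im_predP y : reflect (exists x, f x = y) (y \in im_pred).
Proof. by rewrite inE; apply: asboolP. Qed.

Definition coker : zmodType := quot im_pred.

End Image.

Record additive_functor (A : preadditive_category) := AdditiveFunctor {
  fobj :> A -> zmodType;
  fmap : forall X Y : A, hom X Y -> {additive fobj X -> fobj Y};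
  fmap1 : forall X x, fmap (idm X) x = x;
  fmap_comp : forall X Y Z (g : hom Y Z) (f : hom X Y) x,
    fmap (g \oc f) x = fmap g (fmap f x);
  fmapD : forall X Y (f g : hom X Y) x, fmap (f + g) x = fmap f x + fmap g x
}.

Arguments fmap {A} _ {X Y}.
Arguments fmap1 {A} _ {X}.
Arguments fmap_comp {A} _ {X Y Z}.
Arguments fmapD {A} _ {X Y}.

Record natural_transformation (A : preadditive_category)
    (G H : additive_functor A) := NaturalTransformation {
  component :> forall X : A, {additive G X -> H X};
  naturality : forall (X Y : A) (f : hom X Y) x,
    component Y (fmap G f x) = fmap H f (component X x)
}.

Section FunctorNotions.
Variable A : preadditive_category.
Implicit Types F G H : additive_functor A.

Definition zero_functor F : Prop := forall (X : A) (x : F X), x = 0.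

(* Kernels, cokernels, monos and epis of functors are taken objectwise. *)
Definition natural_epic G H (t : natural_transformation G H) : Prop :=
  forall X, ab_epi (t X).

Definition natural_monic G H (t : natural_transformation G H) : Prop :=
  forall X, ab_mono (t X).

Definition natural_iso G H (t : natural_transformation G H) : Prop :=
  exists u : natural_transformation H G,
    forall X, cancel (t X) (u X) /\ cancel (u X) (t X).

Definition epi_preserving F : Prop :=
  forall (X Y : A) (f : hom X Y), epi f -> ab_epi (fmap F f).

Definition mono_preserving F : Prop :=
  forall (X Y : A) (f : hom X Y), mono f -> ab_mono (fmap F f).

Definition half_exact F : Prop :=
  forall (X Y Z : A) (f : hom X Y) (g : hom Y Z),
    short_exact f g -> ab_exact (fmap F f) (fmap F g).

Definition left_exact F : Prop :=
  forall (X Y Z : A) (f : hom X Y) (g : hom Y Z),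
    short_exact f g ->
    injective (fmap F f) /\ ab_exact (fmap F f) (fmap F g).

End FunctorNotions.

Section FunctorTheory.
Variables (A : preadditive_category) (F : additive_functor A).

Lemma fmapB X Y (f g : hom X Y) x :
  fmap F (f - g) x = fmap F f x - fmap F g x.
Proof. by apply/eqP; rewrite eq_sym subr_eq -fmapD subrK. Qed.

Lemma fmap0 X Y x : fmap F (0 : hom X Y) x = 0.
Proof. by rewrite -(subrr (0 : hom X Y)) fmapB subrr. Qed.

End FunctorTheory.

(* A resolution is recorded in spliced form: short exact sequences
   0 -> Sigma^i B -m_i-> I^i -e_i-> Sigma^(i+1) B -> 0 with Sigma^0 B = B,
   the coboundary I^i -> I^(i+1) being d_i = m_(i+1) e_i.  [ir_syz j] is
   Sigma^(j+1) B, so that Sigma^0 B is B on the nose. *)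

Definition cosyzygy (A : preadditive_category) (B : A) (s : nat -> A)
  (i : nat) : A := if i is j.+1 then s j else B.

Record injective_resolution (A : preadditive_category) (B : A) :=
  InjectiveResolution {
  ir_obj : nat -> A;
  ir_syz : nat -> A;
  ir_m : forall i, hom (cosyzygy B ir_syz i) (ir_obj i);
  ir_e : forall i, hom (ir_obj i) (cosyzygy B ir_syz i.+1);
  ir_injective : forall i, injective_object (ir_obj i);
  ir_mono : forall i, mono (ir_m i);
  ir_coker : forall i, is_cokernel (ir_e i) (ir_m i)
}.

Arguments ir_m {A B}.
Arguments ir_e {A B}.
Arguments ir_injective {A B}.
Arguments ir_mono {A B}.
Arguments ir_coker {A B}.

Section Resolutions.
Variable A : preadditive_category.
Implicit Types B C D : A.

Definition Sigma B (r : injective_resolution B) (i : nat) : A :=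
  cosyzygy B (ir_syz r) i.

Definition ir_d B (r : injective_resolution B) (i : nat) :
  hom (ir_obj r i) (ir_obj r i.+1) := ir_m r i.+1 \oc ir_e r i.

(* The morphisms [s i] and [p i] assemble into a morphism of the spliced
   resolutions. *)
Definition is_lift B C (rB : injective_resolution B)
    (rC : injective_resolution C)
    (s : forall i, hom (Sigma rB i) (Sigma rC i))
    (p : forall i, hom (ir_obj rB i) (ir_obj rC i)) : Prop :=
  (forall i, ir_m rC i \oc s i = p i \oc ir_m rB i) /\
  (forall i, ir_e rC i \oc p i = s i.+1 \oc ir_e rB i).

Lemma lift_exists B C (rB : injective_resolution B)
    (rC : injective_resolution C) (f : hom B C) :
  exists (s : forall i, hom (Sigma rB i) (Sigma rC i)) p,
    s 0 = f /\ is_lift s p.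
Proof.
pose ext i (g : hom (Sigma rB i) (Sigma rC i)) :=
  cid (ir_injective rC i _ _ _ (ir_mono rB i) (ir_m rC i \oc g)).
have desc_ex i (g : hom (Sigma rB i) (Sigma rC i)) : exists h,
  h \oc ir_e rB i = ir_e rC i \oc projT1 (ext i g).
  have [_ U] := ir_coker rB i.
  have E : (ir_e rC i \oc projT1 (ext i g)) \oc ir_m rB i = 0.
    have [eC0 _] := ir_coker rC i.
    by rewrite -compA (projT2 (ext i g)) compA eC0 comp0m.
  by have [h [hE _]] := U _ _ E; exists h.
pose desc i g := cid (desc_ex i g).
pose fix s (i : nat) : hom (Sigma rB i) (Sigma rC i) :=
  match i with 0 => f | j.+1 => projT1 (desc j (s j)) end.
exists s, (fun i => projT1 (ext i (s i))); split=> //; split=> i.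
  by rewrite (projT2 (ext i (s i))).
by rewrite /= (projT2 (desc i (s i))).
Qed.

Lemma lift_null B C (rB : injective_resolution B)
    (rC : injective_resolution C) s p :
  @is_lift B C rB rC s p -> s 0 = 0 ->
  exists h : forall i, hom (ir_obj rB i.+1) (ir_obj rC i),
   [/\ p 0%N = h 0%N \oc ir_d rB 0,
       forall i, s i.+1 = (ir_e rC i \oc h i) \oc ir_m rB i.+1
     & forall i, p i.+1 = ir_d rC i \oc h i + h i.+1 \oc ir_d rB i.+1].
Proof.
move=> [sm se] s0.
(* if s_i = u m_i then p_i = m_i u + h d_i for some h *)
have step i (u : hom (ir_obj rB i) (Sigma rC i)) : s i = u \oc ir_m rB i ->
    exists h : hom (ir_obj rB i.+1) (ir_obj rC i),
      p i = ir_m rC i \oc u + h \oc ir_d rB i.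
  move=> E.
  have E0 : (p i - ir_m rC i \oc u) \oc ir_m rB i = 0.
    by rewrite compBl -sm E compA subrr.
  have [_ U] := ir_coker rB i; have [t [tE _]] := U _ _ E0.
  have [h hE] := ir_injective rC i _ _ _ (ir_mono rB i.+1) t.
  by exists h; rewrite /ir_d compA hE tE addrC subrK.
have next i (u : hom (ir_obj rB i) (Sigma rC i))
    (h : hom (ir_obj rB i.+1) (ir_obj rC i)) :
    p i = ir_m rC i \oc u + h \oc ir_d rB i ->
    s i.+1 = (ir_e rC i \oc h) \oc ir_m rB i.+1.
  move=> E; apply: (cokernel_epi (ir_coker rB i)).
  have [eC0 _] := ir_coker rC i.
  by rewrite -se E compDr compA eC0 comp0m add0r /ir_d !compA.
pose T i := {x : hom (ir_obj rB i) (Sigma rC i) * hom (ir_obj rB i.+1) (ir_obj rC i) |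
              p i = ir_m rC i \oc x.1 + x.2 \oc ir_d rB i}.
have T0 : {t : T 0%N | (sval t).1 = 0}.
  have s00 : s 0%N = 0 \oc ir_m rB 0 by rewrite comp0m.
  by have [h hE] := cid (step _ _ s00); exists (exist _ (0, h) hE).
have TS i (t : T i) : {t' : T i.+1 | (sval t').1 = ir_e rC i \oc (sval t).2}.
  case: t => -[u h] /= E.
  have [h' h'E] := cid (step _ _ (next _ _ _ E)).
  by exists (exist _ (ir_e rC i \oc h, h') h'E).
pose fix t (i : nat) : T i :=
  match i with 0 => projT1 T0 | j.+1 => projT1 (TS j (t j)) end.
exists (fun i => (sval (t i)).2); split=> [|i|i].
- by rewrite {1}(svalP (t 0%N)) /= (projT2 T0) compm0 add0r.
- exact: (next _ _ _ (svalP (t i))).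
by rewrite {1}(svalP (t i.+1)) (projT2 (TS i (t i))) compA.
Qed.

Lemma is_lift1 B (r : injective_resolution B) :
  @is_lift B B r r (fun i => idm _) (fun i => idm _).
Proof. by split=> i; rewrite comp1m compm1. Qed.

Lemma is_lift_comp B C D (rB : injective_resolution B)
    (rC : injective_resolution C) (rD : injective_resolution D) s p s' p' :
  @is_lift B C rB rC s p -> @is_lift C D rC rD s' p' ->
  @is_lift B D rB rD (fun i => s' i \oc s i) (fun i => p' i \oc p i).
Proof.
move=> [sm se] [sm' se']; split=> i /=.
  by rewrite compA sm' -[LHS]compA sm compA.
by rewrite compA se' -[LHS]compA se compA.
Qed.

Lemma is_liftD B C (rB : injective_resolution B)
    (rC : injective_resolution C) s p s' p' :
  @is_lift B C rB rC s p -> @is_lift B C rB rC s' p' ->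
  @is_lift B C rB rC (fun i => s i + s' i) (fun i => p i + p' i).
Proof.
by move=> [sm se] [sm' se']; split=> i;
   rewrite compDr compDl ?sm ?sm' ?se ?se'.
Qed.

Lemma is_liftB B C (rB : injective_resolution B)
    (rC : injective_resolution C) s p s' p' :
  @is_lift B C rB rC s p -> @is_lift B C rB rC s' p' ->
  @is_lift B C rB rC (fun i => s i - s' i) (fun i => p i - p' i).
Proof.
by move=> [sm se] [sm' se']; split=> i;
   rewrite compBr compBl ?sm ?sm' ?se ?se'.
Qed.

Lemma ir_em B (r : injective_resolution B) i : ir_e r i \oc ir_m r i = 0.
Proof. by have [] := ir_coker r i. Qed.

Lemma ir_dd B (r : injective_resolution B) i : ir_d r i.+1 \oc ir_d r i = 0.
Proof.
by rewrite /ir_d compA -(compA (ir_m r i.+2)) ir_em compm0 comp0m.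
Qed.

Lemma lift_d B C (rB : injective_resolution B)
    (rC : injective_resolution C) s p :
  @is_lift B C rB rC s p ->
  forall i, ir_d rC i \oc p i = p i.+1 \oc ir_d rB i.
Proof. by move=> [sm se] i; rewrite /ir_d -[LHS]compA se [LHS]compA sm compA. Qed.

End Resolutions.

Lemma injective_resolutions_exist (A : abelian_category) :
  enough_injectives A -> inhabited (forall B : A, injective_resolution B).
Proof.
move=> enough.
have step (X : A) : {I : A & {Q : A & {m : hom X I & {e : hom I Q |
    [/\ injective_object I, mono m & is_cokernel e m]}}}}.
  have [I /cid[m [Iinj mm]]] := cid (enough X).
  have [Q /cid[e eE]] := cid (has_cokernels m).
  by exists I, Q, m, e.
constructor=> B.
pose nxt X := projT1 (projT2 (step X)).
pose syz j := iter j.+1 nxt B.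
have dat (i : nat) (X := cosyzygy B syz i) :
    {I : A & {m : hom X I & {e : hom I (cosyzygy B syz i.+1) |
    [/\ injective_object I, mono m & is_cokernel e m]}}}.
  exists (projT1 (step X)).
  case: i @X => [|j] X.
    exists (projT1 (projT2 (projT2 (step B)))).
    exists (projT1 (projT2 (projT2 (projT2 (step B))))).
    exact: (projT2 (projT2 (projT2 (projT2 (step B))))).
  exists (projT1 (projT2 (projT2 (step (syz j))))).
  exists (projT1 (projT2 (projT2 (projT2 (step (syz j)))))).
  exact: (projT2 (projT2 (projT2 (projT2 (step (syz j)))))).
by exists (fun i => projT1 (dat i)) syz
  (fun i => projT1 (projT2 (dat i)))
  (fun i => projT1 (projT2 (projT2 (dat i)))) => i;
  case: (projT2 (projT2 (projT2 (dat i)))).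
Qed.

Section Groups.
Variables (A : preadditive_category) (F : additive_functor A).
Implicit Types B C : A.

Section Object.
Variables (B : A) (r : injective_resolution B).

(* The value at B of the sub-stabilization of F composed with Sigma^i: since
   m_i embeds Sigma^i B in an injective, it is the kernel of F(m_i). *)
Definition stab_obj (i : nat) : zmodType := ker (fmap F (ir_m r i)).

Definition sat_obj (i : nat) : zmodType :=
  match i with
  | 0 => F B
  | j.+1 => coker (fmap F (ir_e r j))
  end.

Definition sat_proj (i : nat) : {additive F (Sigma r i) -> sat_obj i} :=
  match i return {additive F (Sigma r i) -> sat_obj i} with
  | 0 => idfun
  | j.+1 => quot_proj (im_pred (fmap F (ir_e r j)))
  end.

Definition cocycles (i : nat) : zmodType := ker (fmap F (ir_d r i)).

Definition cobdry (i : nat) : {pred cocycles i} :=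
  match i return {pred cocycles i} with
  | 0 => [pred x | x == 0]
  | j.+1 => [pred x | val x \in im_pred (fmap F (ir_d r j))]
  end.

Arguments cobdry : clear implicits.

Lemma cobdry_zmod_closed i : zmod_closed (cobdry i).
Proof.
case: i => [|j]; split=> [|x y].
- by rewrite inE.
- by rewrite !inE => /eqP-> /eqP->; rewrite subrr.
- by apply/asboolP; exists 0; rewrite !raddf0.
move=> /asboolP[a xE] /asboolP[b yE]; apply/asboolP.
by exists (a - b); rewrite !raddfB xE yE.
Qed.

HB.instance Definition _ i :=
  GRing.isZmodClosed.Build (cocycles i) (cobdry i) (cobdry_zmod_closed i).

Definition der_obj (i : nat) : zmodType := quot (cobdry i).

Definition der_proj (i : nat) : {additive cocycles i -> der_obj i} :=
  quot_proj (cobdry i).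

Lemma sat_proj_surj i (x : sat_obj i) : exists y, sat_proj i y = x.
Proof. by case: i x => [|j] x; [exists x | exact: quot_proj_surj]. Qed.

Lemma sat_proj0_eq0 x : sat_proj 0 x = 0 -> x = 0.
Proof. by []. Qed.

Lemma sat_projS_eq0 j x :
  sat_proj j.+1 x = 0 <-> exists y, fmap F (ir_e r j) y = x.
Proof.
by split=> [/quot_proj_eq0/im_predP | /im_predP/quot_proj_eq0].
Qed.

(* The map induced on S^i F(B) by a map on F(Sigma^i B). *)
Definition sat_lift (i : nat) (V : zmodType) :
    forall g : {additive F (Sigma r i) -> V},
    (forall x, sat_proj i x = 0 -> g x = 0) -> {additive sat_obj i -> V} :=
  match i return forall g : {additive F (Sigma r i) -> V},
    (forall x, sat_proj i x = 0 -> g x = 0) -> {additive sat_obj i -> V} with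
  | 0 => fun g _ => g
  | j.+1 => fun g g0 =>
      quot_lift (fun x xI => g0 x ((quot_proj_eq0 _ x).2 xI))
  end.

Lemma sat_liftE i V g g0 x : @sat_lift i V g g0 (sat_proj i x) = g x.
Proof. by case: i g g0 x => [|j] g g0 x //; exact: quot_liftE. Qed.

Lemma der_proj_surj i (x : der_obj i) : exists y, der_proj i y = x.
Proof. exact: quot_proj_surj. Qed.

Lemma der_proj0_eq0 x : der_proj 0 x = 0 <-> x = 0.
Proof.
split=> [/quot_proj_eq0 | ->]; last exact: raddf0.
by rewrite inE => /eqP.
Qed.

Lemma der_projS_eq0 j x :
  der_proj j.+1 x = 0 <-> exists y, fmap F (ir_d r j) y = val x.
Proof.
by split=> [/quot_proj_eq0 /asboolP | H] //; apply/quot_proj_eq0/asboolP.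
Qed.

Definition der_lift (i : nat) (V : zmodType)
    (g : {additive cocycles i -> V})
    (g0 : forall x, der_proj i x = 0 -> g x = 0) : {additive der_obj i -> V} :=
  quot_lift (fun x xI => g0 x ((quot_proj_eq0 _ x).2 xI)).

Lemma der_liftE i V g g0 x : @der_lift i V g g0 (der_proj i x) = g x.
Proof. exact: quot_liftE. Qed.

Definition stab_to_sat (i : nat) : {additive stab_obj i -> sat_obj i} :=
  sat_proj i \o val.

Lemma ir_m_cocycle i x : fmap F (ir_d r i) (fmap F (ir_m r i) x) = 0.
Proof. by rewrite -fmap_comp /ir_d -compA ir_em compm0 fmap0. Qed.

Definition m_cocycle (i : nat) : {additive F (Sigma r i) -> cocycles i} :=
  to_ker (@ir_m_cocycle i).

Lemma sat_to_der_subproof i x :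
  sat_proj i x = 0 -> (der_proj i \o m_cocycle i) x = 0.
Proof.
case: i x => [|j] x; first by move=> /sat_proj0_eq0->; rewrite raddf0.
move=> /sat_projS_eq0[y <-]; apply/der_projS_eq0; exists y.
by rewrite /= -fmap_comp.
Qed.

Definition sat_to_der (i : nat) : {additive sat_obj i -> der_obj i} :=
  sat_lift (@sat_to_der_subproof i).

Lemma e_stab_subproof i (x : cocycles i) :
  fmap F (ir_m r i.+1) ((fmap F (ir_e r i) \o val) x) = 0.
Proof. by rewrite /= -fmap_comp; exact: kerP. Qed.

Definition e_stab (i : nat) : {additive cocycles i -> stab_obj i.+1} :=
  to_ker (@e_stab_subproof i).

Lemma der_to_stab_subproof i x : der_proj i x = 0 -> e_stab i x = 0.
Proof.
case: i x => [|j] x; first by move=> /der_proj0_eq0->; rewrite raddf0.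
move=> /der_projS_eq0[y xE]; apply: val_inj.
by rewrite /= -xE -fmap_comp /ir_d compA ir_em comp0m fmap0.
Qed.

Definition der_to_stab (i : nat) : {additive der_obj i -> stab_obj i.+1} :=
  der_lift (@der_to_stab_subproof i).

End Object.

Section Morphism.
Variables (B C : A) (rB : injective_resolution B) (rC : injective_resolution C).
Variable s : forall i, hom (Sigma rB i) (Sigma rC i).
Variable p : forall i, hom (ir_obj rB i) (ir_obj rC i).
Hypothesis L : is_lift s p.

Lemma stab_map_subproof i (x : stab_obj rB i) :
  fmap F (ir_m rC i) ((fmap F (s i) \o val) x) = 0.
Proof. by rewrite /= -fmap_comp L.1 fmap_comp kerP raddf0. Qed.

Definition stab_map i : {additive stab_obj rB i -> stab_obj rC i} :=
  to_ker (@stab_map_subproof i).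

Lemma sat_map_subproof i x :
  sat_proj rB i x = 0 -> (sat_proj rC i \o fmap F (s i)) x = 0.
Proof.
case: i x => [|j] x; first by move=> /sat_proj0_eq0->; rewrite raddf0.
move=> /sat_projS_eq0[y <-]; apply/sat_projS_eq0; exists (fmap F (p j) y).
by rewrite -!fmap_comp L.2.
Qed.

Definition sat_map i : {additive sat_obj rB i -> sat_obj rC i} :=
  sat_lift (@sat_map_subproof i).

Lemma cocycle_map_subproof i (x : cocycles rB i) :
  fmap F (ir_d rC i) ((fmap F (p i) \o val) x) = 0.
Proof. by rewrite /= -fmap_comp (lift_d L) fmap_comp kerP raddf0. Qed.

Definition cocycle_map i : {additive cocycles rB i -> cocycles rC i} :=
  to_ker (@cocycle_map_subproof i).

Lemma der_map_subproof i x :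
  der_proj rB i x = 0 -> (der_proj rC i \o cocycle_map i) x = 0.
Proof.
case: i x => [|j] x; first by move=> /der_proj0_eq0->; rewrite raddf0.
move=> /der_projS_eq0[y xE]; apply/der_projS_eq0; exists (fmap F (p j) y).
by rewrite /= -xE -!fmap_comp (lift_d L).
Qed.

Definition der_map i : {additive der_obj rB i -> der_obj rC i} :=
  der_lift (@der_map_subproof i).

Lemma sat_mapE i x : sat_map i (sat_proj rB i x) = sat_proj rC i (fmap F (s i) x).
Proof. exact: sat_liftE. Qed.

Lemma der_mapE i x : der_map i (der_proj rB i x) = der_proj rC i (cocycle_map i x).
Proof. exact: der_liftE. Qed.

Lemma sat_to_derE D (r : injective_resolution D) i x :
  sat_to_der r i (sat_proj r i x) = der_proj r i (m_cocycle r i x).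
Proof. exact: sat_liftE. Qed.

Lemma der_to_stabE D (r : injective_resolution D) i x :
  der_to_stab r i (der_proj r i x) = e_stab r i x.
Proof. exact: der_liftE. Qed.

Lemma stab_to_sat_natural i x :
  stab_to_sat rC i (stab_map i x) = sat_map i (stab_to_sat rB i x).
Proof. by rewrite /= sat_mapE. Qed.

Lemma sat_to_der_natural i x :
  sat_to_der rC i (sat_map i x) = der_map i (sat_to_der rB i x).
Proof.
have [y <-] := sat_proj_surj x.
rewrite sat_mapE !sat_to_derE der_mapE; congr (der_proj _ _ _).
by apply: val_inj; rewrite /= -!fmap_comp L.1.
Qed.

Lemma der_to_stab_natural i x :
  der_to_stab rC i (der_map i x) = stab_map i.+1 (der_to_stab rB i x).
Proof.
have [y <-] := der_proj_surj x; rewrite der_mapE !der_to_stabE.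
by apply: val_inj; rewrite /= -!fmap_comp L.2.
Qed.

End Morphism.

Section Independence.
Variables (B C : A) (rB : injective_resolution B) (rC : injective_resolution C).
Variables (s s' : forall i, hom (Sigma rB i) (Sigma rC i)).
Variables (p p' : forall i, hom (ir_obj rB i) (ir_obj rC i)).
Hypotheses (L : is_lift s p) (L' : is_lift s' p') (s0 : s 0 = s' 0).

Let null := lift_null (is_liftB L L') (etrans (congr1 (+%R^~ _) s0) (subrr _)).

Lemma stab_map_unique i x : stab_map L i x = stab_map L' i x.
Proof.
apply: val_inj; apply/eqP; rewrite /= -subr_eq0 -fmapB.
have [h [_ sE _]] := null; case: i x => [|j] x.
  by rewrite s0 subrr fmap0.
by rewrite sE fmap_comp kerP raddf0.
Qed.

Lemma sat_map_unique i x : sat_map L i x = sat_map L' i x.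
Proof.
have [y <-] := sat_proj_surj x; rewrite !sat_mapE.
apply/eqP; rewrite -subr_eq0 -raddfB -fmapB; apply/eqP.
have [h [_ sE _]] := null; case: i x y => [|j] x y.
  by rewrite s0 subrr fmap0 raddf0.
by apply/sat_projS_eq0; rewrite sE -compA fmap_comp; eexists.
Qed.

Lemma der_map_unique i x : der_map L i x = der_map L' i x.
Proof.
have [y <-] := der_proj_surj x; rewrite !der_mapE.
apply/eqP; rewrite -subr_eq0 -raddfB; apply/eqP.
have [h [p0 _ pE]] := null; case: i x y => [|j] x y.
  apply/der_proj0_eq0/val_inj.
  by rewrite raddfB /= -fmapB p0 fmap_comp kerP raddf0.
apply/der_projS_eq0; exists (fmap F (h j) (val y)).
by rewrite raddfB /= -fmapB pE fmapD -fmap_comp (fmap_comp _ (h j.+1)) kerP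
   raddf0 addr0.
Qed.

End Independence.
End Groups.

Section FundamentalSequence.
Variables (A : preadditive_category) (F : additive_functor A).
Variable res : forall B : A, injective_resolution B.
Implicit Types B C D : A.

Let lift_s_ex B C (f : hom B C) := cid (lift_exists (res B) (res C) f).

Definition lift_s B C (f : hom B C) := projT1 (lift_s_ex f).
Definition lift_p B C (f : hom B C) := projT1 (cid (projT2 (lift_s_ex f))).

Lemma lift_s0 B C (f : hom B C) : lift_s f 0 = f.
Proof. by have [] := projT2 (cid (projT2 (lift_s_ex f))). Qed.

Lemma lift_is_lift B C (f : hom B C) : is_lift (lift_s f) (lift_p f).
Proof. by have [] := projT2 (cid (projT2 (lift_s_ex f))). Qed.

(* Maps induced by f : B -> C.  They are computed from a chosen lift of f to
   the resolutions, and do not depend on it: see [stab_map_unique],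
   [sat_map_unique] and [der_map_unique]. *)
Definition stab_fmap i B C (f : hom B C) := stab_map F (lift_is_lift f) i.
Definition sat_fmap i B C (f : hom B C) := sat_map F (lift_is_lift f) i.
Definition der_fmap i B C (f : hom B C) := der_map F (lift_is_lift f) i.

Lemma stab_fmap1 i B x : stab_fmap i (idm B) x = x.
Proof.
rewrite /stab_fmap (stab_map_unique _ (is_lift1 (res B))) ?lift_s0 //.
by apply: val_inj; rewrite /= fmap1.
Qed.

Lemma stab_fmap_comp i B C D (g : hom C D) (f : hom B C) x :
  stab_fmap i (g \oc f) x = stab_fmap i g (stab_fmap i f x).
Proof.
rewrite /stab_fmap.
rewrite (stab_map_unique _ (is_lift_comp (lift_is_lift f) (lift_is_lift g)))
  ?lift_s0 //.
by apply: val_inj; rewrite /= fmap_comp.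
Qed.

Lemma stab_fmapD i B C (f g : hom B C) x :
  stab_fmap i (f + g) x = stab_fmap i f x + stab_fmap i g x.
Proof.
rewrite /stab_fmap.
rewrite (stab_map_unique _ (is_liftD (lift_is_lift f) (lift_is_lift g)))
  ?lift_s0 //.
by apply: val_inj; rewrite /= fmapD.
Qed.

Lemma sat_fmap1 i B x : sat_fmap i (idm B) x = x.
Proof.
rewrite /sat_fmap (sat_map_unique _ (is_lift1 (res B))) ?lift_s0 //.
by have [y <-] := sat_proj_surj x; rewrite sat_mapE fmap1.
Qed.

Lemma sat_fmap_comp i B C D (g : hom C D) (f : hom B C) x :
  sat_fmap i (g \oc f) x = sat_fmap i g (sat_fmap i f x).
Proof.
rewrite /sat_fmap.
rewrite (sat_map_unique _ (is_lift_comp (lift_is_lift f) (lift_is_lift g)))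
  ?lift_s0 //.
by have [y <-] := sat_proj_surj x; rewrite !sat_mapE fmap_comp.
Qed.

Lemma sat_fmapD i B C (f g : hom B C) x :
  sat_fmap i (f + g) x = sat_fmap i f x + sat_fmap i g x.
Proof.
rewrite /sat_fmap.
rewrite (sat_map_unique _ (is_liftD (lift_is_lift f) (lift_is_lift g)))
  ?lift_s0 //.
by have [y <-] := sat_proj_surj x; rewrite !sat_mapE fmapD raddfD.
Qed.

Lemma der_fmap1 i B x : der_fmap i (idm B) x = x.
Proof.
rewrite /der_fmap (der_map_unique _ (is_lift1 (res B))) ?lift_s0 //.
have [y <-] := der_proj_surj x; rewrite der_mapE; congr (der_proj _ _ _ _).
by apply: val_inj; rewrite /= fmap1.
Qed.

Lemma der_fmap_comp i B C D (g : hom C D) (f : hom B C) x :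
  der_fmap i (g \oc f) x = der_fmap i g (der_fmap i f x).
Proof.
rewrite /der_fmap.
rewrite (der_map_unique _ (is_lift_comp (lift_is_lift f) (lift_is_lift g)))
  ?lift_s0 //.
have [y <-] := der_proj_surj x; rewrite !der_mapE; congr (der_proj _ _ _ _).
by apply: val_inj; rewrite /= fmap_comp.
Qed.

Lemma der_fmapD i B C (f g : hom B C) x :
  der_fmap i (f + g) x = der_fmap i f x + der_fmap i g x.
Proof.
rewrite /der_fmap.
rewrite (der_map_unique _ (is_liftD (lift_is_lift f) (lift_is_lift g)))
  ?lift_s0 //.
have [y <-] := der_proj_surj x; rewrite !der_mapE -raddfD.
by congr (der_proj _ _ _ _); apply: val_inj; rewrite /= fmapD.
Qed.

Definition stab_functor i : additive_functor A :=
  AdditiveFunctor (@stab_fmap1 i) (@stab_fmap_comp i) (@stab_fmapD i).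

Definition sat_functor i : additive_functor A :=
  match i with
  | 0 => F
  | j.+1 =>
    AdditiveFunctor (@sat_fmap1 j.+1) (@sat_fmap_comp j.+1) (@sat_fmapD j.+1)
  end.

Definition der_functor i : additive_functor A :=
  AdditiveFunctor (@der_fmap1 i) (@der_fmap_comp i) (@der_fmapD i).

Lemma sat_fmap0 B C (f : hom B C) x : sat_fmap 0 f x = fmap F f x.
Proof. by rewrite -[in RHS](lift_s0 f). Qed.

Lemma stab_sat_naturality i B C (f : hom B C) x :
  stab_to_sat F (res C) i (stab_fmap i f x) =
  sat_fmap i f (stab_to_sat F (res B) i x).
Proof. exact: stab_to_sat_natural. Qed.

Lemma sat_der_naturality i B C (f : hom B C) x :
  sat_to_der F (res C) i (sat_fmap i f x) =
  der_fmap i f (sat_to_der F (res B) i x).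
Proof. exact: sat_to_der_natural. Qed.

Lemma der_stab_naturality i B C (f : hom B C) x :
  der_to_stab F (res C) i (der_fmap i f x) =
  stab_fmap i.+1 f (der_to_stab F (res B) i x).
Proof. exact: der_to_stab_natural. Qed.

Lemma stab_sat_naturality0 B C (f : hom B C) x :
  stab_to_sat F (res C) 0 (stab_fmap 0 f x) =
  fmap F f (stab_to_sat F (res B) 0 x).
Proof. by rewrite stab_sat_naturality sat_fmap0. Qed.

Lemma sat_der_naturality0 B C (f : hom B C) x :
  sat_to_der F (res C) 0 (fmap F f x) =
  der_fmap 0 f (sat_to_der F (res B) 0 x).
Proof. by rewrite -sat_der_naturality sat_fmap0. Qed.

Definition stab_to_sat_nt i :
    natural_transformation (stab_functor i) (sat_functor i) :=
  match i return natural_transformation (stab_functor i) (sat_functor i) with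
  | 0 => @NaturalTransformation A (stab_functor 0) F
           (fun B => stab_to_sat F (res B) 0) stab_sat_naturality0
  | j.+1 => @NaturalTransformation A (stab_functor j.+1) (sat_functor j.+1)
           (fun B => stab_to_sat F (res B) j.+1) (@stab_sat_naturality j.+1)
  end.

Definition sat_to_der_nt i :
    natural_transformation (sat_functor i) (der_functor i) :=
  match i return natural_transformation (sat_functor i) (der_functor i) with
  | 0 => @NaturalTransformation A F (der_functor 0)
           (fun B => sat_to_der F (res B) 0) sat_der_naturality0
  | j.+1 => @NaturalTransformation A (sat_functor j.+1) (der_functor j.+1)
           (fun B => sat_to_der F (res B) j.+1) (@sat_der_naturality j.+1)
  end.

Definition der_to_stab_nt i :
    natural_transformation (der_functor i) (stab_functor i.+1) :=
  @NaturalTransformation A (der_functor i) (stab_functor i.+1)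
    (fun B => der_to_stab F (res B) i) (@der_stab_naturality i).

End FundamentalSequence.

(* Positions in the sequence: [Stab i], [Sat i] and [Der i] are those of the
   i-th cosyzygy composite of the sub-stabilization, of S^i F and of R^i F. *)
Inductive position := Stab of nat | Sat of nat | Der of nat.

Definition next (q : position) : position :=
  match q with Stab i => Sat i | Sat i => Der i | Der i => Stab i.+1 end.

Section RightFundamentalSequence.
Variables (A : preadditive_category) (F : additive_functor A).
Variable res : forall B : A, injective_resolution B.

Definition rfs_term (q : position) : additive_functor A :=
  match q with
  | Stab i => stab_functor F res i
  | Sat i => sat_functor F res i
  | Der i => der_functor F res i
  end.

Definition rfs_map (q : position) :
    natural_transformation (rfs_term q) (rfs_term (next q)) :=
  match q return natural_transformation (rfs_term q) (rfs_term (next q)) with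
  | Stab i => stab_to_sat_nt F res i
  | Sat i => sat_to_der_nt F res i
  | Der i => der_to_stab_nt F res i
  end.

Definition sub_stabilization : additive_functor A := rfs_term (Stab 0).

Definition rho : natural_transformation F (der_functor F res 0) :=
  rfs_map (Sat 0).

Definition beta :
    natural_transformation (der_functor F res 0) (stab_functor F res 1) :=
  rfs_map (Der 0).

Definition rfs_is_complex : Prop :=
  forall (q : position) (B : A) (x : rfs_term q B),
    rfs_map (next q) B (rfs_map q B x) = 0.

(* Vanishing of the homology at a position, i.e. kernel = image, objectwise;
   the map arriving at [Stab 0] is the zero map. *)
Definition rfs_exact_at (q : position) : Prop :=
  match q with
  | Stab 0 => forall (B : A) (x : rfs_term (Stab 0) B),
                rfs_map (Stab 0) B x = 0 -> x = 0
  | Stab i.+1 => forall B : A, ab_exact (rfs_map (Der i) B) (rfs_map (Stab i.+1) B)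
  | Sat i => forall B : A, ab_exact (rfs_map (Stab i) B) (rfs_map (Sat i) B)
  | Der i => forall B : A, ab_exact (rfs_map (Sat i) B) (rfs_map (Der i) B)
  end.

End RightFundamentalSequence.

(* Main.v *)
(** All exactness claims reduce to diagram chases with the short exact
    sequences [0 -> Sigma^i B -> I^i -> Sigma^(i+1) B -> 0]; half-exactness is
    only needed to identify [Ker F(e_i)] with [Im F(m_i)].  If [rho] is an
    isomorphism, then every [F(m_0)] is injective, so [F] preserves monos: a
    mono [f : X -> Y] is a factor [t f = m_0] of the embedding of [X] in an
    injective.  Given moreover a cokernel [g : Y -> Z] of [f] and [y] in
    [Ker F(g)], the element [F(t) y] is a cocycle, hence equals [F(m_0) x] for
    some [x]; then [y - F(f) x] is killed by [F] of the mono
    [(t, g) : Y -> I^0 + Z], so that [y = F(f) x].  This avoids comparing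
    resolutions of [X], [Y] and [Z]. *)

From mathcomp Require Import all_boot all_algebra.
From mathcomp Require Import boolp.
Require Import Defs.

Set Implicit Arguments.
Unset Strict Implicit.
Unset Printing Implicit Defensive.

Import GRing.Theory.
Local Open Scope ring_scope.

(** * Epis and monos of abelian groups as surjections and injections *)

Section AbelianGroups.
Variables U V : zmodType.

Lemma additive_inj (f : {additive U -> V}) :
  (forall x, f x = 0 -> x = 0) -> injective f.
Proof.
move=> f0 x y fxy; apply/eqP; rewrite -subr_eq0; apply/eqP/f0.
by rewrite raddfB fxy subrr.
Qed.

(** The projection onto the cokernel and the zero map agree after [f], hence are equal. *)
Lemma ab_epi_surj (f : {additive U -> V}) :
  ab_epi f -> forall y, exists x, f x = y.
Proof.
move=> epi_f y; apply/(im_predP f)/(quot_proj_eq0 (im_pred f)).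
apply: (epi_f _ (quot_proj (im_pred f)) (mk_additive (f := fun=> 0) _)).
  by move=> ? ?; rewrite subrr.
by move=> fB x; apply/quot_proj_eq0/im_predP; exists x.
Qed.

Lemma surj_ab_epi (f : {additive U -> V}) :
  (forall y, exists x, f x = y) -> ab_epi f.
Proof. by move=> surj_f W g h ghE y; have [x <-] := surj_f y. Qed.

(** Test [f] on the inclusion of its kernel and the zero map. *)
Lemma ab_mono_inj (f : {additive U -> V}) : ab_mono f -> injective f.
Proof.
move=> mono_f; apply: additive_inj => x fx0.
pose k : {additive ker f -> U} := val.
have k0 : zmod_morphism (fun _ : ker f => 0 : U).
  by move=> ? ?; rewrite subrr.
apply: (mono_f _ k (mk_additive k0) _ (Sub x (mem_ker fx0))) => z.
by rewrite kerP raddf0.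
Qed.

Lemma inj_ab_mono (f : {additive U -> V}) : injective f -> ab_mono f.
Proof. by move=> inj_f W g h ghE x; apply: inj_f. Qed.

End AbelianGroups.

(** * Monos and short exact sequences in the source category *)

Section Categories.
Variable C : preadditive_category.

Lemma kernel_mono (K X Y : C) (k : hom K X) (f : hom X Y) :
  is_kernel k f -> mono k.
Proof.
move=> [fk0 U] W g h khE.
have [l [_ lU]] : exists! l, k \oc l = k \oc h.
  by apply: U; rewrite compA fk0 comp0m.
by rewrite -(lU g khE) -(lU h erefl).
Qed.

Lemma mono_eq0 (X Y : C) (m : hom X Y) :
  (forall W (g : hom W X), m \oc g = 0 -> g = 0) -> mono m.
Proof.
move=> m0 W g h mE; apply/eqP; rewrite -subr_eq0; apply/eqP/m0.
by rewrite compBr mE subrr.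
Qed.

End Categories.

(** [m] is a kernel of some [g], and [g] factors through [e]; so whatever [e] kills is killed by [g]
    and lifts through [m]. *)
Lemma mono_coker_short_exact (A : abelian_category) (X Y Q : A)
    (m : hom X Y) (e : hom Y Q) :
  mono m -> is_cokernel e m -> short_exact m e.
Proof.
move=> /mono_is_kernel[Z [g [gm0 mU]]] eE; split=> //; split=> [|W h eh0].
  by case: eE.
apply: mU; have [_ /(_ _ g gm0)[k [<- _]]] := eE.
by rewrite -compA eh0 compm0.
Qed.

Lemma resolution_short_exact (A : abelian_category) (B : A)
    (r : injective_resolution B) i : short_exact (ir_m r i) (ir_e r i).
Proof. exact: mono_coker_short_exact (ir_mono r i) (ir_coker r i). Qed.

(** * The sequence at a fixed object *)

Section Object.
Variables (A : preadditive_category) (F : additive_functor A).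
Variables (B : A) (r : injective_resolution B).

Lemma stab_to_sat_to_der i x : sat_to_der F r i (stab_to_sat F r i x) = 0.
Proof.
rewrite /= sat_to_derE -[RHS](raddf0 (der_proj F r i)).
by congr (der_proj _ _ _ _); apply: val_inj; rewrite /= kerP.
Qed.

Lemma sat_to_der_to_stab i x : der_to_stab F r i (sat_to_der F r i x) = 0.
Proof.
have [y <-] := sat_proj_surj x; rewrite sat_to_derE der_to_stabE.
by apply: val_inj; rewrite /= -fmap_comp ir_em fmap0.
Qed.

Lemma der_to_stab_to_sat i x :
  stab_to_sat F r i.+1 (der_to_stab F r i x) = 0.
Proof.
have [y <-] := der_proj_surj x; rewrite der_to_stabE.
by apply/sat_projS_eq0; exists (val y).
Qed.

Lemma stab_to_sat0_inj : injective (stab_to_sat F r 0).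
Proof. exact: val_inj. Qed.

(** An element of Ker F(m_(i+1)) that dies in the satellite is some F(e_i) y; as d_i = m_(i+1) e_i,
    [y] is a cocycle. *)
Lemma stab_exact i : ab_exact (der_to_stab F r i) (stab_to_sat F r i.+1).
Proof.
move=> x; split=> [/sat_projS_eq0[y yE]|[y <-]]; last first.
  exact: der_to_stab_to_sat.
have dy0 : fmap F (ir_d r i) y = 0 by rewrite /ir_d fmap_comp yE kerP.
exists (der_proj F r i (Sub y (mem_ker dy0))).
by rewrite der_to_stabE; apply: val_inj.
Qed.

Lemma sat_exact i : ab_exact (stab_to_sat F r i) (sat_to_der F r i).
Proof.
move=> x; split=> [|[y <-]]; last exact: stab_to_sat_to_der.
have [y <-] := sat_proj_surj x; rewrite sat_to_derE => my0.
(* The class of [y] has a representative in Ker F(m_i): if i = j+1 and F(m_i) y = F(d_j) w, subtract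
   F(e_j) w, which is zero in the satellite. *)
have [z [zE mz0]] :
    exists z, sat_proj F r i z = sat_proj F r i y /\ fmap F (ir_m r i) z = 0.
  case: i {x} y my0 => [|j] y.
    by move=> /der_proj0_eq0/(congr1 val) my0; exists y.
  move=> /der_projS_eq0[w wE]; exists (y - fmap F (ir_e r j) w); split.
    rewrite raddfB; suff -> : sat_proj F r j.+1 (fmap F (ir_e r j) w) = 0.
      by rewrite subr0.
    by apply/sat_projS_eq0; exists w.
  by rewrite raddfB -fmap_comp -/(ir_d r j) wE subrr.
by exists (Sub z (mem_ker mz0)); rewrite -zE.
Qed.

Lemma der_exact i :
  ab_exact (fmap F (ir_m r i)) (fmap F (ir_e r i)) ->
  ab_exact (sat_to_der F r i) (der_to_stab F r i).
Proof.
move=> FE x; split=> [|[y <-]]; last exact: sat_to_der_to_stab.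
have [y <-] := der_proj_surj x; rewrite der_to_stabE => /(congr1 val) /=.
move=> /FE[z zE]; exists (sat_proj F r i z); rewrite sat_to_derE.
by congr (der_proj _ _ _ _); apply: val_inj.
Qed.

(** If F(e_i) is onto, its cokernel vanishes, so the next map is zero and [stab_exact] applies. *)
Lemma der_to_stab_surj i :
  (forall y, exists x, fmap F (ir_e r i) x = y) ->
  forall y, exists x, der_to_stab F r i x = y.
Proof.
move=> surj_e y; apply/stab_exact/sat_projS_eq0.
by have [x xE] := surj_e (val y); exists x.
Qed.

Lemma rhoE x : sat_to_der F r 0 x = der_proj F r 0 (m_cocycle F r 0 x).
Proof. exact: (@sat_to_derE A F B r 0). Qed.

(** In degree 0 the only coboundary is 0, so nothing is lost in passing to classes. *)
Lemma rho_eq0 x : sat_to_der F r 0 x = 0 <-> fmap F (ir_m r 0) x = 0.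
Proof.
rewrite rhoE; split=> [/der_proj0_eq0/(congr1 val)|] //.
by move=> mx0; apply/der_proj0_eq0/val_inj.
Qed.

Lemma rho_inj : injective (fmap F (ir_m r 0)) -> injective (sat_to_der F r 0).
Proof.
move=> inj_m; apply: additive_inj => x /rho_eq0 mx0.
by apply: inj_m; rewrite mx0 raddf0.
Qed.

Lemma rho_surj :
  (forall y, fmap F (ir_d r 0) y = 0 -> exists x, fmap F (ir_m r 0) x = y) ->
  forall y, exists x, sat_to_der F r 0 x = y.
Proof.
move=> ker_d y; have [z <-] := der_proj_surj y.
have [x xE] := ker_d _ (kerP z); exists x.
rewrite rhoE.
by congr (der_proj _ _ _ _); apply: val_inj.
Qed.

Lemma inj_fmap_m : injective (sat_to_der F r 0) -> injective (fmap F (ir_m r 0)).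
Proof.
move=> inj_rho; apply: additive_inj => x /rho_eq0 rx0.
by apply: inj_rho; rewrite rx0 raddf0.
Qed.

Lemma ker_fmap_d :
  (forall y, exists x, sat_to_der F r 0 x = y) ->
  forall y, fmap F (ir_d r 0) y = 0 -> exists x, fmap F (ir_m r 0) x = y.
Proof.
move=> surj_rho y dy0.
pose z : cocycles F r 0 := Sub y (mem_ker dy0).
have [x] := surj_rho (der_proj F r 0 z).
rewrite rhoE => /eqP; rewrite -subr_eq0 -raddfB.
move=> /eqP/der_proj0_eq0/eqP; rewrite subr_eq0 => /eqP/(congr1 val) /= xE.
by exists x.
Qed.

End Object.

(** * Inverting natural transformations objectwise *)

Section NaturalIso.
Variables (A : preadditive_category) (G H : additive_functor A).
Variable t : natural_transformation G H.

(** Inverses are picked by choice; their additivity and naturality follow by cancelling the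
    injective [t]. *)
Lemma natural_iso_bij :
  (forall X, injective (t X)) -> (forall X y, exists x, t X x = y) ->
  natural_iso t.
Proof.
move=> inj_t surj_t; pose u X y := projT1 (cid (surj_t X y)).
have tu X : cancel (u X) (t X) by move=> y; exact: projT2 (cid (surj_t X y)).
have uB X : zmod_morphism (u X).
  by move=> x y; apply: inj_t; rewrite raddfB !tu.
have uN X Y (f : hom X Y) x :
    mk_additive (uB Y) (fmap H f x) = fmap G f (mk_additive (uB X) x).
  by apply: inj_t; rewrite naturality /= !tu.
exists (NaturalTransformation uN) => X; split; last exact: tu.
by move=> x; apply: inj_t; rewrite tu.
Qed.

End NaturalIso.

(** * Left-exactness and bijectivity of [rho] *)

Section LeftExact.
Variables (A : abelian_category) (F : additive_functor A).

(** The morphism (f, g) into the biproduct is mono, so [F] sends it to an injection. *)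
Lemma jointly_inj (X Y Z : A) (f : hom X Y) (g : hom X Z) :
  (forall (V W : A) (m : hom V W), mono m -> injective (fmap F m)) ->
  (forall W (h : hom W X), f \oc h = 0 -> g \oc h = 0 -> h = 0) ->
  forall x, fmap F f x = 0 -> fmap F g x = 0 -> x = 0.
Proof.
move=> Fmono fg0 x fx0 gx0.
have [P [i1 [i2 [p1 [p2 [p1i1 p2i2 p1i2 p2i1 _]]]]]] := has_biproducts Y Z.
have mono_fg : mono (i1 \oc f + i2 \oc g).
  apply: mono_eq0 => W h; rewrite compDl -!compA => h0; apply: fg0.
    move/(congr1 (comp p1)): h0; rewrite compDr !compA p1i1 p1i2 comp1m !comp0m.
    by rewrite addr0 compm0.
  move/(congr1 (comp p2)): h0; rewrite compDr !compA p2i1 p2i2 comp1m !comp0m.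
  by rewrite add0r compm0.
apply: (Fmono _ _ _ mono_fg).
by rewrite fmapD !fmap_comp fx0 gx0 !raddf0 addr0.
Qed.

Variable res : forall B : A, injective_resolution B.

Lemma left_exact_of_kernels :
  (forall B, injective (fmap F (ir_m (res B) 0))) ->
  (forall B y, fmap F (ir_d (res B) 0) y = 0 ->
     exists x, fmap F (ir_m (res B) 0) x = y) ->
  left_exact F.
Proof.
move=> inj_m ker_d.
have Fmono (V W : A) (k : hom V W) : mono k -> injective (fmap F k).
  move=> mono_k x y kE.
  have [t tE] := ir_injective (res V) 0 _ _ _ mono_k (ir_m (res V) 0).
  by apply: inj_m; rewrite -tE !fmap_comp kE.
move=> X Y Z f g [fker [gf0 gU]]; have mono_f := kernel_mono fker.
split=> [|y]; first exact: Fmono.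
split=> [gy0|[x <-]]; last by rewrite -fmap_comp gf0 fmap0.
pose m : hom X _ := ir_m (res X) 0; pose e := ir_e (res X) 0.
have [t tE] : exists t, t \oc f = m by exact: ir_injective mono_f m.
(* Since e t f = e m = 0, e t factors through the cokernel [g]; hence F(g) y = 0 makes F(t) y a
   cocycle. *)
have [u [uE _]] : exists! u, u \oc g = e \oc t.
  by apply: gU; rewrite -compA tE; exact: (ir_em (res X) 0).
have [x xE] : exists x, fmap F m x = fmap F t y.
  apply: ker_d; rewrite /ir_d -fmap_comp -compA -/e -uE.
  by rewrite !fmap_comp gy0 !raddf0.
exists x; apply/eqP; rewrite eq_sym -subr_eq0; apply/eqP.
apply: (jointly_inj (f := t) (g := g) Fmono).
(* [t] and [g] are jointly monic: g h = 0 gives h = f v, and then m v = t h = 0 forces v = 0. *)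
- move=> W h th0 gh0; have [_ /(_ _ h gh0)[v [vE _]]] := fker.
  suff v0 : v = 0 by rewrite -vE v0 compm0.
  apply: (ir_mono (res X) 0).
  by rewrite -/m compm0 -tE -compA vE.
- by rewrite raddfB -fmap_comp tE xE subrr.
by rewrite raddfB gy0 -fmap_comp gf0 fmap0 subrr.
Qed.

Lemma rho_iso_left_exact : natural_iso (rho F res) <-> left_exact F.
Proof.
split=> [[u uK]|Fle].
  apply: left_exact_of_kernels => B; have [tu ut] := uK B.
    exact/inj_fmap_m/(can_inj tu).
  by apply: ker_fmap_d => y; exists (u B y); apply: ut.
have inj_m B i := (Fle _ _ _ _ _ (resolution_short_exact (res B) i)).1.
have exact_m B i := (Fle _ _ _ _ _ (resolution_short_exact (res B) i)).2.
apply: natural_iso_bij => B; first exact: rho_inj (inj_m B 0).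
(* As d_0 = m_1 e_0 and F(m_1) is injective, Ker F(d_0) lies in Ker F(e_0) = Im F(m_0). *)
apply: rho_surj => y dy0; apply/exact_m/inj_m.
by rewrite -fmap_comp raddf0.
Qed.

End LeftExact.

Theorem theorem3p2 (A : abelian_category) (enough : enough_injectives A)
    (F : additive_functor A) (res : forall B : A, injective_resolution B) :
  (rfs_is_complex F res /\
   forall q : position, (forall i : nat, q <> Der i) -> rfs_exact_at F res q) /\
  (half_exact F -> forall q : position, rfs_exact_at F res q) /\
  (epi_preserving F -> natural_epic (beta F res)) /\
  (mono_preserving F ->
     zero_functor (sub_stabilization F res) /\ natural_monic (rho F res)) /\
  (natural_iso (rho F res) <-> left_exact F).
Proof.
(* Shared by the first two claims; the second then only has the positions [Der i] left. *)
have exact_off_der q : (forall i, q <> Der i) -> rfs_exact_at F res q.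
  case: q => [[|i]|[|i]|i] qD B //=; last by case: (qD i).
  - by move=> x x0; apply: stab_to_sat0_inj; rewrite raddf0.
  - exact: stab_exact.
  - exact: sat_exact.
  - exact: sat_exact.
split; first split=> //.
  case=> [[|i]|[|i]|i] B x /=.
  - exact: stab_to_sat_to_der.
  - exact: stab_to_sat_to_der.
  - exact: sat_to_der_to_stab.
  - exact: sat_to_der_to_stab.
  - exact: der_to_stab_to_sat.
split.
  move=> Fhe [i|i|i]; try exact: exact_off_der.
  by case: i => [|i] B; apply: der_exact; apply: Fhe;
    exact: resolution_short_exact.
split.
  move=> Fepi B; apply/surj_ab_epi/der_to_stab_surj/ab_epi_surj/Fepi.
  exact: cokernel_epi (ir_coker (res B) 0).
split; last exact: rho_iso_left_exact.
move=> Fmono.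
have inj_m B : injective (fmap F (ir_m (res B) 0)).
  exact/ab_mono_inj/Fmono/ir_mono.
split=> [B x|B]; last exact/inj_ab_mono/rho_inj.
by apply: val_inj; apply: inj_m; rewrite kerP !raddf0.
Qed.
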